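(* Let $A$ be a $C^*$-algebra, $H$ a Hilbert $A$-module, and let $P,Q\in\mathcal{L}(H)$ be two projections such that $\overline{\mathcal{R}(P+Q)}$ is orthogonally complemented in $H$. For every $n\in\mathbb{N}$ (with $n\geq 1$), let $T_n=\left(P+Q+\frac{1}{n}I\right)^{-1}$ and $$A_n=P-PT_nP,\quad B_n=PT_nQ,\quad C_n=Q-QT_nQ.$$ Then the following statements are equivalent: (i) one of the sequences $\{A_n\}$, $\{B_n\}$, $\{C_n\}$ is convergent in the strict topology; (ii) all of $\{A_n\}$, $\{B_n\}$, $\{C_n\}$ are convergent to the same limit in the strict topology; (iii) $\mathcal{R}(P)\cap\mathcal{R}(Q)$ is orthogonally complemented in $H$ and $\big(\mathcal{R}(P)\cap\mathcal{R}(Q)\big)^\perp=\overline{\mathcal{R}(2I-P-Q)}$; (iv) $\overline{\mathcal{R}(2I-P-Q)}$ is orthogonally complemented in $H$. In each case, $$\lim_{n\to\infty}A_n=\lim_{n\to\infty}B_n=\lim_{n\to\infty}C_n=\tfrac12 P_{\mathcal{R}(P)\cap\mathcal{R}(Q)}\quad\text{in the strict topology.}$$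
   Context: $\mathcal{L}(H)$ is the $C^*$-algebra of adjointable operators on the Hilbert $A$-module $H$, and $I$ is the identity operator. A projection is an operator $P\in\mathcal{L}(H)$ with $P=P^2=P^*$. $\mathcal{R}(T)$ denotes the range of $T$. For a closed submodule $M\subseteq H$, $M^\perp=\{x\in H:\langle x,y\rangle=0\text{ for all }y\in M\}$; $M$ is orthogonally complemented in $H$ if $H=M\dotplus M^\perp$ (i.e. $H=M+M^\perp$), and then $P_M\in\mathcal{L}(H)$ denotes the projection with range $M$. The strict topology on $\mathcal{L}(H)$ is the one determined by the seminorms $T\mapsto\|Tx\|$ and $T\mapsto\|T^*x\|$ $(x\in H)$; convergence means convergence to an element of $\mathcal{L}(H)$. *)

(* Defs.v *)
From HB Require Import structures.
From mathcomp Require Import all_boot all_order all_algebra.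
From mathcomp Require Import complex.
From mathcomp Require Import all_classical all_reals all_analysis.
Import Order.TTheory GRing.Theory Num.Theory.
Import numFieldNormedType.Exports.

Set Implicit Arguments.
Unset Strict Implicit.
Unset Printing Implicit Defensive.

Local Open Scope classical_set_scope.
Local Open Scope ring_scope.
Local Open Scope complex_scope.

(* C*-algebras need not be unital, so the multiplication is not taken from the
   (unital) ring hierarchy.  Norms of completeNormedModType R[i] are R[i]-valued
   and nonnegative, hence real. *)
HB.mixin Record isCStarAlgebra (R : realType) A
    of CompleteNormedModule R[i] A := {
  cmul : A -> A -> A;
  cstar : A -> A;
  cmulA : forall a b c, cmul a (cmul b c) = cmul (cmul a b) c;
  cmulDl : forall a b c, cmul (a + b) c = cmul a c + cmul b c;
  cmulDr : forall a b c, cmul a (b + c) = cmul a b + cmul a c;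
  cmulZl : forall (k : R[i]) a b, cmul (k *: a) b = k *: cmul a b;
  cmulZr : forall (k : R[i]) a b, cmul a (k *: b) = k *: cmul a b;
  cstarK : forall a, cstar (cstar a) = a;
  cstarD : forall a b, cstar (a + b) = cstar a + cstar b;
  cstarZ : forall (k : R[i]) a, cstar (k *: a) = k^* *: cstar a;
  cstarM : forall a b, cstar (cmul a b) = cmul (cstar b) (cstar a);
  cmul_norm : forall a b, `|cmul a b| <= `|a| * `|b|;
  cstar_norm : forall a, `|cmul (cstar a) a| = `|a| ^+ 2
}.

#[short(type="cstarAlgType")]
HB.structure Definition CStarAlgebra (R : realType) :=
  {A of isCStarAlgebra R A & CompleteNormedModule R[i] A}.

Definition cpos (R : realType) (A : cstarAlgType R) (a : A) : Prop :=
  exists b : A, a = cmul (cstar b) b.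

(* Right modules, with inner products linear in the second variable.  By
   hact_scalel and hact_scaler the scalar actions of H and A are compatible. *)
HB.mixin Record isHilbertModule (R : realType) (A : cstarAlgType R) H
    of CompleteNormedModule R[i] H := {
  hact : H -> A -> H;
  inner : H -> H -> A;
  hactDl : forall x y a, hact (x + y) a = hact x a + hact y a;
  hactDr : forall x a b, hact x (a + b) = hact x a + hact x b;
  hactM : forall x a b, hact x (cmul a b) = hact (hact x a) b;
  hact_scalel : forall (k : R[i]) x a, hact (k *: x) a = k *: hact x a;
  hact_scaler : forall (k : R[i]) x a, hact x (k *: a) = k *: hact x a;
  innerDr : forall x y z, inner x (y + z) = inner x y + inner x z;
  innerZr : forall (k : R[i]) x y, inner x (k *: y) = k *: inner x y;
  innerMr : forall x y a, inner x (hact y a) = cmul (inner x y) a;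
  inner_sym : forall x y, inner y x = cstar (inner x y);
  inner_pos : forall x, cpos (inner x x);
  inner_eq0 : forall x, inner x x = 0 -> x = 0;
  inner_norm : forall x : H, `|x| ^+ 2 = `|inner x x|
}.

#[short(type="hilbertModType")]
HB.structure Definition HilbertModule (R : realType) (A : cstarAlgType R) :=
  {H of isHilbertModule R A H & CompleteNormedModule R[i] H}.
Arguments inner {R A s} _ _.
Arguments hact {R A s} _ _.

Section Inner.
Variables (R : realType) (A : cstarAlgType R) (H : hilbertModType A).
Implicit Types x y z : H.

Lemma innerDl x y z : inner (x + y) z = inner x z + inner y z.
Proof. by rewrite inner_sym innerDr cstarD -!inner_sym. Qed.

Lemma innerZl (k : R[i]) x y : inner (k *: x) y = k^* *: inner x y.
Proof. by rewrite inner_sym innerZr cstarZ -inner_sym. Qed.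

Lemma inner0l x : inner (0 : H) x = 0.
Proof. by apply: (addrI (inner (0 : H) x)); rewrite -innerDl !addr0. Qed.

Lemma inner0r x : inner x (0 : H) = 0.
Proof. by apply: (addrI (inner x (0 : H))); rewrite -innerDr !addr0. Qed.

End Inner.

(* Adjointable operators: maps with an adjoint.  The adjoint is determined by
   the map (inner is nondegenerate), and such maps are automatically bounded
   and A-linear, so Leibniz equality is equality of the underlying maps. *)
Record adjop (R : realType) (A : cstarAlgType R) (H : hilbertModType A) :=
  AdjOp {
    adjop_fun :> H -> H;
    adjop_adj : H -> H;
    _ : forall x y, inner (adjop_fun x) y = inner x (adjop_adj y)
  }.
Arguments adjop {R A} H.

Section AdjOp.
Variables (R : realType) (A : cstarAlgType R) (H : hilbertModType A).
Local Notation L := (adjop H).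
Implicit Types (S T U : L) (x y : H).

Lemma adjopP T x y : inner (T x) y = inner x (adjop_adj T y).
Proof. by case: T. Qed.

Fact adjop_star_subproof T x y : inner (adjop_adj T x) y = inner x (T y).
Proof. by rewrite inner_sym -adjopP -inner_sym. Qed.

Definition adj T : L := AdjOp (adjop_star_subproof T).

Lemma inner_inj x y : (forall z, inner z x = inner z y) -> x = y.
Proof.
move=> xy; apply/eqP; rewrite -subr_eq0; apply/eqP/inner_eq0.
by rewrite innerDr -[- y]scaleN1r innerZr xy !scaleN1r subrr.
Qed.

Lemma adjop_ext S T : S =1 T -> S = T.
Proof.
move=> ST; have ST' : adjop_adj S =1 adjop_adj T.
  by move=> y; apply: inner_inj => x; rewrite -!adjopP ST.
move: ST ST'; case: S T => [f f' Hf] [g g' Hg] /= /funext fg /funext fg'.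
by subst; congr AdjOp; exact: Prop_irrelevance.
Qed.

Fact adjop0_subproof x y : inner ((fun=> 0) x : H) y = inner x ((fun=> 0) y).
Proof. by rewrite inner0l inner0r. Qed.
Definition adjop0 : L := AdjOp adjop0_subproof.

Fact adjop1_subproof x y : inner (id x : H) y = inner x (id y).
Proof. by []. Qed.
Definition adjop1 : L := AdjOp adjop1_subproof.

Fact adjopD_subproof S T x y :
  inner (S x + T x) y = inner x (adjop_adj S y + adjop_adj T y).
Proof. by rewrite innerDl innerDr !adjopP. Qed.
Definition adjopD S T : L := AdjOp (adjopD_subproof S T).

Fact adjopZ_subproof (k : R[i]) T x y :
  inner (k *: T x) y = inner x (k^* *: adjop_adj T y).
Proof. by rewrite innerZl innerZr adjopP. Qed.
Definition adjopZ k T : L := AdjOp (adjopZ_subproof k T).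

Fact adjopM_subproof S T x y :
  inner (S (T x)) y = inner x (adjop_adj T (adjop_adj S y)).
Proof. by rewrite !adjopP. Qed.
Definition adjopM S T : L := AdjOp (adjopM_subproof S T).

Definition adjopN T : L := adjopZ (-1) T.

HB.instance Definition _ := gen_eqMixin L.
HB.instance Definition _ := gen_choiceMixin L.

Fact adjopDA : associative adjopD.
Proof. by move=> S T U; apply: adjop_ext => x /=; rewrite addrA. Qed.
Fact adjopDC : commutative adjopD.
Proof. by move=> S T; apply: adjop_ext => x /=; rewrite addrC. Qed.
Fact adjop0D : left_id adjop0 adjopD.
Proof. by move=> T; apply: adjop_ext => x /=; rewrite add0r. Qed.
Fact adjopND : left_inverse adjop0 adjopN adjopD.
Proof. by move=> T; apply: adjop_ext => x /=; rewrite scaleN1r addNr. Qed.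
HB.instance Definition _ :=
  GRing.isZmodule.Build L adjopDA adjopDC adjop0D adjopND.

Lemma adjop_additive T x y : T (x + y) = T x + T y.
Proof.
by apply: inner_inj => z; rewrite innerDr -!(adjopP (adj T)) innerDr.
Qed.

Fact adjopMA : associative adjopM.
Proof. by move=> S T U; apply: adjop_ext. Qed.
Fact adjop1M : left_id adjop1 adjopM.
Proof. by move=> T; apply: adjop_ext. Qed.
Fact adjopM1 : right_id adjop1 adjopM.
Proof. by move=> T; apply: adjop_ext. Qed.
Fact adjopMDl : left_distributive adjopM +%R.
Proof. by move=> S T U; apply: adjop_ext. Qed.
Fact adjopMDr : right_distributive adjopM +%R.
Proof. by move=> S T U; apply: adjop_ext => x; exact: adjop_additive. Qed.
HB.instance Definition _ :=
  GRing.Zmodule_isPzRing.Build L adjopMA adjop1M adjopM1 adjopMDl adjopMDr.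

Fact adjopZA (a b : R[i]) T : adjopZ a (adjopZ b T) = adjopZ (a * b) T.
Proof. by apply: adjop_ext => x /=; rewrite scalerA. Qed.
Fact adjop1Z : left_id 1 adjopZ.
Proof. by move=> T; apply: adjop_ext => x /=; rewrite scale1r. Qed.
Fact adjopZDr : right_distributive adjopZ +%R.
Proof. by move=> a S T; apply: adjop_ext => x /=; rewrite scalerDr. Qed.
Fact adjopZDl T : {morph adjopZ^~ T : a b / a + b}.
Proof. by move=> a b; apply: adjop_ext => x /=; rewrite scalerDl. Qed.
HB.instance Definition _ :=
  GRing.Zmodule_isLmodule.Build R[i] L adjopZA adjop1Z adjopZDr adjopZDl.

(* Inverse in L(H); the value is 0 if T is not invertible. *)
Definition opinv T : L := xget 0 [set U : L | U * T = 1 /\ T * U = 1].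

Definition is_projection T : Prop := T = T * T /\ T = adj T.

Definition orthocompl (M : set H) : set H :=
  [set x | forall y, M y -> inner x y = 0].

Definition orthocomplemented (M : set H) : Prop :=
  forall x, exists y z, [/\ M y, orthocompl M z & x = y + z].

Definition is_projection_onto (M : set H) T : Prop :=
  is_projection T /\ range T = M.

(* The topology of the seminorms T |-> `|T x| and T |-> `|adj T x|. *)
Definition strict_topology :=
  initial_topology (fun T : L => (fun x => (T x, adj T x)) : {ptws H -> (H * H)%type}).

Definition strict_cvg (u : nat -> L) (T : L) : Prop :=
  u @ \oo --> (T : strict_topology).

Lemma strict_cvgP (u : nat -> L) T : strict_cvg u T <->
  forall x, u n x @[n --> \oo] --> T x /\
            adj (u n) x @[n --> \oo] --> adj T x.
Proof.
pose f (S : L) : {ptws H -> (H * H)%type} := fun x => (S x, adj S x).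
have -> : strict_cvg u T <-> {ptws, (f \o u) @ \oo --> f T}.
  split=> [uT V fV|fuT V].
    have /uT : nbhs (T : strict_topology) (f @^-1` V).
      exact: (@initial_continuous _ _ f).
    by [].
  case=> _ [[W oW <-] WT WV]; apply: filterS WV _.
  by apply: fuT; exact: open_nbhs_nbhs.
rewrite pointwise_cvgP; split=> uT x.
  split; [apply: (cvg_comp _ _ (uT x) cvg_fst)|apply: (cvg_comp _ _ (uT x) cvg_snd)].
by have [? ?] := uT x; exact: cvg_pair.
Qed.

End AdjOp.

(* Main.v *)
From HB Require Import structures.
Require Import Defs.
From mathcomp Require Import all_boot all_order all_algebra.
From mathcomp Require Import complex.
From mathcomp Require Import all_classical all_reals all_analysis.
Import Order.TTheory GRing.Theory Num.Theory.
Import numFieldNormedType.Exports.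

Local Open Scope classical_set_scope.
Local Open Scope ring_scope.
Local Open Scope complex_scope.

(** With W = P + Q - 1 = ((2P - 1) + (2Q - 1)) / 2, the mean of two isometries,
    P + Q + e = (1 + e) + W and 2 - P - Q + e = (1 + e) - W are invertible for
    every e > 0, and their inverses T and T' satisfy |eTx| <= |x| and
    |eT'x| <= |x|; no order on A or on L(H) is needed.  Since
    (1 + e)^2 - W^2 commutes with P, one finds
    P - PTP = (e/2) P(T + T').  Here e = 1/n.  As the closure of R(P + Q) is
    complemented and ker(P + Q) = ker P /\ ker Q, the operators ePT and eTQ tend
    strictly to 0; they are the differences A_n - B_n and C_n - B_n, so the three
    sequences converge together, exactly when ePT' does.  If they tend to L, then
    eT' tends pointwise to 2L, whose values lie in ker(2 - P - Q) while those of
    1 - 2L lie in the closure of R(2 - P - Q): this is (iv).  Conversely, under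
    (iv), eT' tends pointwise to the projection onto
    ker(2 - P - Q) = R(P) /\ R(Q). *)

(* Both a := p + q + c and b := (1 - p) + (1 - q) + c have sum 2(1 + c), and their
   product (1 + c)^2 - (p + q - 1)^2 commutes with p. *)
Lemma projection_resolvent_identity (K : pzRingType) (p q c t t' : K) :
    p * p = p -> q * q = q -> (forall x, c * x = x * c) ->
    t * (p + q + c) = 1 -> (p + q + c) * t = 1 ->
    t' * ((1 - p) + (1 - q) + c) = 1 -> ((1 - p) + (1 - q) + c) * t' = 1 ->
  (p - p * t * p) *+ 2 = c * p * (t + t').
Proof.
set a := p + q + c; set b := (1 - p) + (1 - q) + c.
move=> pp qq cC ta aT t'b bt'; pose d := 1 + c.
have dC x : d * x = x * d by rewrite mulrDl mulrDr mul1r mulr1 cC.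
have pa : p * a = d * p + p * q.
  by rewrite !mulrDr pp mulrDl mul1r cC addrAC.
have pb : p * b = d * p - p * q.
  by rewrite !mulrDr !mulrN pp !mulr1 subrr add0r mulrDl mul1r cC addrAC.
have qb : q * b = d * q - q * p.
  rewrite !mulrDr !mulrN qq !mulr1 subrr addr0 mulrDl mul1r cC.
  by rewrite addrAC.
have aq : a * q = d * q + p * q.
  by rewrite !mulrDl qq mul1r [RHS]addrC addrA.
have ap : a * p = d * p + q * p.
  by rewrite !mulrDl pp mul1r addrAC.
have bp : b * p = d * p - q * p.
  by rewrite !mulrDl !mulNr pp !mul1r subrr add0r addrAC.
have kp : a * b * p = d * d * p - p * q * p.
  have -> : a * b * p = d * (a * p) - (a * q) * p.
    by rewrite -mulrA bp mulrBr mulrA -(dC a) !mulrA.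
  by rewrite ap aq (mulrDl (d * q)) (mulrDr d) !mulrA opprD addrA addrK.
have pk : p * (a * b) = a * b * p.
  rewrite kp mulrA pa (mulrDl (d * p)) -!mulrA pb qb !mulrBr.
  by rewrite (mulrA p d) -(dC p) !mulrA addrA subrK.
have k1 : a * b * (t' * t) = 1 by rewrite mulrA -(mulrA a) bt' mulr1.
have tt' : t + t' = d *+ 2 * (t' * t).
  have -> : t + t' = t' * (a + b) * t.
    by rewrite mulrDr mulrDl t'b mul1r -mulrA aT mulr1 addrC.
  have -> : a + b = d *+ 2.
    by rewrite mulr2n addrACA (addrACA p) !subrKC [RHS]addrACA.
  by rewrite mulrnAr !mulrnAl -dC mulrA.
have ptpk : p * t * p * (a * b) = d * p - p * q * p.
  rewrite -mulrA pk !mulrA -(mulrA p t a) ta mulr1 pb.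
  by rewrite (mulrBl p) -(mulrA d) pp.
have dd : d * d * p - d * p = d * c * p.
  by rewrite {2}/d mulrDr mulr1 (mulrDl d) addrAC subrr add0r.
(* Since [t' * t] is a right inverse of [a * b], it suffices to compare both sides after
   multiplication by [a * b] on the right. *)
have main : p - p * t * p = d * c * p * (t' * t).
  rewrite -[LHS]mulr1 -k1 mulrA; congr (_ * _).
  by rewrite mulrBl pk kp ptpk opprB addrA subrK.
rewrite main tt' mulrnAl mulrnAr; congr (_ *+ 2).
by rewrite [in RHS]mulrA -dC !mulrA.
Qed.

(** * Scalars in [R[i]]: order, limits and the contraction principle *)

Lemma pos_complexP (R : realType) (e : R[i]) :
  0 < e -> exists2 r : R, 0 < r & e = r%:C.
Proof.
move=> e0; have eE := RRe_real (gtr0_real e0).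
by exists (complex.Re e); rewrite ?eE// -(ltcR 0) eE.
Qed.

(** The order of [R[i]] compares only numbers with equal imaginary parts, so a positive bound is
    real and the limit reduces to one in [R]. *)
Lemma near_infty_natSinv_lt_complex (R : realType) (e : R[i]) :
  0 < e -> \forall n \near \oo, n.+1%:R^-1 < e.
Proof.
move=> /pos_complexP[r r0 ->]; near=> n.
rewrite (_ : n.+1%:R^-1 = (n.+1%:R^-1 : R)%:C); last first.
  by rewrite fmorphV rmorph_nat.
by rewrite ltcR; near: n; exact: (near_infty_natSinv_lt (PosNum r0)).
Unshelve. all: by end_near. Qed.

Lemma near_infty_expr_lt_complex (R : realType) (q e : R[i]) :
  0 < q < 1 -> 0 < e -> \forall n \near \oo, q ^+ n < e.
Proof.
move=> /andP[/pos_complexP[s s0 ->] s1] /pos_complexP[r r0 ->].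
have {}s1 : `|s| < 1 by rewrite gtr0_norm// -ltcR.
near=> n; rewrite -rmorphXn ltcR -[_ ^+ n]ger0_norm ?exprn_ge0 ?ltW//.
by near: n; exact: (cvgr0_norm_lt _ (cvg_expr s1) _ r0).
Unshelve. all: by end_near. Qed.

(** Banach's fixed point theorem for [R[i]]-valued norms, by iteration from 0. *)
Lemma complex_contraction_fixpoint (R : realType)
    (V : completeNormedModType R[i]) (f : V -> V) (q : R[i]) :
  0 < q < 1 -> (forall x y, `|f x - f y| <= q * `|x - y|) ->
  exists x, f x = x.
Proof.
move=> q01 fq; have /andP[q0 q1] := q01.
pose u n := iter n f 0.
have q1' : 0 < 1 - q by rewrite subr_gt0.
pose C := `|f 0| / (1 - q).
have C0 : 0 <= C by rewrite mulr_ge0 ?invr_ge0 // ltW.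
have uS n : `|u n.+1 - u n| <= q ^+ n * `|f 0|.
  elim: n => [|n IH]; first by rewrite expr0 mul1r subr0.
  apply: (le_trans (fq _ _)); rewrite exprS -mulrA ler_wpM2l// ltW//.
(* Going from [u n] to [u m] through [u n.+1] and [u m.+1] costs at most [q] times the distance
   itself plus two consecutive steps; solving for the distance avoids summing a geometric series. *)
have uu n m : `|u n - u m| <= (q ^+ n + q ^+ m) * C.
  rewrite mulrA ler_pdivlMr// mulrBr mulr1 mulrDl lerBlDr.
  have : `|u n - u m| <= `|u n.+1 - u n| + `|u n.+1 - u m.+1| + `|u m.+1 - u m|.
    rewrite -(distrC (u n)).
    apply: (le_trans (ler_distD (u m.+1) _ _)); rewrite lerD2r.
    exact: ler_distD.
  move/le_trans; apply; rewrite addrAC lerD// ?lerD//.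
  by rewrite mulrC; exact: fq.
have [l ul] : exists l : V, u @ \oo --> l.
  apply/cvg_ex/cauchy_cvgP/cauchy_ballP => e e0.
  (* [C] vanishes when [f 0 = 0], hence the divisor [C + 1]. *)
  have d0 : 0 < e / (C + 1) / 2 by rewrite !divr_gt0// ltr_wpDl.
  near_simpl; near=> n; rewrite /= -ball_normE /=.
  apply: (le_lt_trans (uu n.1 n.2)).
  apply: (@le_lt_trans _ _ ((q ^+ n.1 + q ^+ n.2) * (C + 1))).
    by rewrite ler_wpM2l ?lerDl// addr_ge0// exprn_ge0 ?ltW.
  rewrite -ltr_pdivlMr ?ltr_wpDl// [ltRHS]splitr ltrD//.
    near: n; exact: (filter_prod1 (near_infty_expr_lt_complex _ _ _ q01 d0)).
  near: n; exact: (filter_prod2 (near_infty_expr_lt_complex _ _ _ q01 d0)).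
have ul' : u n.+1 @[n --> \oo] --> l by rewrite -cvg_shiftS in ul.
exists l; apply: (cvg_unique (@norm_hausdorff _ V) _ ul').
apply/cvgrPdist_lt => e e0; near=> n.
apply: (le_lt_trans (fq _ _)); apply: (@le_lt_trans _ _ `|l - u n|).
  by rewrite ler_piMl// ltW.
by near: n; exact: (cvgr_dist_lt _ _ ul).
Unshelve. all: by end_near. Qed.

(** * Linearity of adjointable operators and rules for adjoints *)

Section HilbertModule.
Variables (R : realType) (A : cstarAlgType R) (H : hilbertModType A).
Implicit Types (D P Q S T U W : adjop H) (x y z : H) (e : R[i]).

Lemma adjop_scalable T : scalable T.
Proof.
by move=> k x; apply: inner_inj => z; rewrite innerZr -!(adjopP (adj T)) innerZr.
Qed.

HB.instance Definition _ T :=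
  GRing.isSemilinear.Build R[i] H H *:%R (adjop_fun T)
    (adjop_scalable T, adjop_additive T).

Lemma adjopDE S T x : (S + T) x = S x + T x. Proof. by []. Qed.
Lemma adjopNE T x : (- T) x = - T x. Proof. exact: scaleN1r. Qed.
Lemma adjopBE S T x : (S - T) x = S x - T x.
Proof. by rewrite adjopDE adjopNE. Qed.
Lemma adjopZE e T x : (e *: T) x = e *: T x. Proof. by []. Qed.
Lemma adjopME S T x : (S * T) x = S (T x). Proof. by []. Qed.
Lemma adjop1E x : (1 : adjop H) x = x. Proof. by []. Qed.
Definition adjopE := (adjopBE, adjopNE, adjopDE, adjopZE, adjopME, adjop1E).

Lemma adjD S T : adj (S + T) = adj S + adj T.
Proof. exact: adjop_ext. Qed.
Lemma adjM S T : adj (S * T) = adj T * adj S.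
Proof. exact: adjop_ext. Qed.
Lemma adjZ e T : adj (e *: T) = e^* *: adj T.
Proof. exact: adjop_ext. Qed.
Lemma adjN T : adj (- T) = - adj T.
Proof.
apply: adjop_ext => x; rewrite adjopNE -[RHS]scaleN1r.
rewrite -[LHS]/((-1)^*%C *: adj T x).
by congr (_ *: _); apply/eqP; rewrite eq_complex /= !(oppr0, eqxx).
Qed.
Lemma adj1 : adj (1 : adjop H) = 1.
Proof. exact: adjop_ext. Qed.

(** * Estimates for the inner product, and orthogonality *)

Lemma innerNr x y : inner x (- y) = - inner x y.
Proof. by rewrite -[in LHS]scaleN1r innerZr scaleN1r. Qed.

Lemma innerBr x y z : inner x (y - z) = inner x y - inner x z.
Proof. by rewrite innerDr innerNr. Qed.

Lemma inner_eq0C x y : inner x y = 0 -> inner y x = 0.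
Proof.
move=> xy; rewrite inner_sym xy; apply: (addrI (cstar (0 : A))).
by rewrite -cstarD !addr0.
Qed.

Lemma norm_i : `|'i%C : R[i]| = 1.
Proof. by rewrite normc_def /= expr0n expr1n add0r sqrtr1. Qed.

Lemma inner_iZl x y : inner ('i%C *: x) y = (- 'i%C) *: inner x y.
Proof.
rewrite innerZl; congr (_ *: _).
by apply/eqP; rewrite eq_complex /= oppr0 !eqxx.
Qed.

(* Polarization replaces the Cauchy-Schwarz inequality, whose proof needs the
   order on A. *)
Lemma inner_le x y : `|inner x y| <= (`|x| + `|y|) ^+ 2 *+ 2.
Proof.
have ii : 'i%C * 'i%C = -1 :> R[i] by rewrite -expr2; exact: sqr_i.
have bound (u v : H) : `|u| = `|x| -> `|v| = `|y| ->
    `|inner u v + inner v u| <= (`|x| + `|y|) ^+ 2 *+ 2.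
  move=> ux vy.
  have -> : inner u v + inner v u =
      inner (u + v) (u + v) - (inner u u + inner v v).
    rewrite innerDl !innerDr (addrC (inner v u)) addrACA.
    by rewrite [RHS]addrC addKr.
  apply: (le_trans (ler_normB _ _)); rewrite mulr2n lerD//.
    by rewrite -inner_norm lerXn2r ?nnegrE ?addr_ge0// -ux -vy ler_normD.
  apply: (le_trans (ler_normD _ _)); rewrite -!inner_norm ux vy sqrrD.
  by rewrite lerD2r lerDl mulrn_wge0// mulr_ge0.
have : `|inner x y *+ 4| <= (`|x| + `|y|) ^+ 2 *+ 2 *+ 4.
  (* The symmetric sum of [x] and ['i *: y], multiplied by [- 'i], is [inner x y - inner y x], so
     [inner y x] cancels. *)
  have -> : inner x y *+ 4 = (inner x y + inner y x) *+ 2 +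
     (- 'i%C) *: ((inner x ('i%C *: y) + inner ('i%C *: y) x) *+ 2).
    rewrite innerZr inner_iZl -scalerMnr -mulrnDl scalerDr !scalerA.
    rewrite mulNr mulrNN ii opprK scale1r scaleN1r.
    by rewrite addrACA subrr addr0 -mulr2n -mulrnA.
  apply: (le_trans (ler_normD _ _)).
  rewrite normrZ normrN norm_i mul1r.
  rewrite !normrMn -[4%N]/(2 * 2)%N [leRHS]mulrnA [leRHS]mulr2n lerD// lerMn2r/=.
    exact: bound.
  by apply: bound; rewrite // normrZ norm_i mul1r.
by rewrite normrMn lerMn2r.
Qed.

Lemma nonexpansive_cvg T (u : nat -> H) l : (forall x, `|T x| <= `|x|) ->
  u n @[n --> \oo] --> l -> T (u n) @[n --> \oo] --> T l.
Proof.
move=> T1 ul; apply/cvgrPdist_lt => e e0; near=> n.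
rewrite -raddfB (le_lt_trans (T1 _))//; near: n.
exact: (cvgr_dist_lt _ _ ul).
Unshelve. all: by end_near. Qed.

Lemma is_projection_compl P : is_projection P -> is_projection (1 - P).
Proof.
move=> [PP PE]; split; last by rewrite adjD adjN adj1 -PE.
by rewrite mulrBr mulr1 mulrBl mul1r -PP subrr subr0.
Qed.

Lemma selfadj_inner S x y : S = adj S -> inner (S x) y = inner x (S y).
Proof. by move=> SE; rewrite adjopP [in RHS]SE. Qed.

Lemma closure_dist (M : set H) x :
  closure M x -> forall e, 0 < e -> exists2 y, M y & `|x - y| < e.
Proof.
move=> Mx e e0; have [y [My xy]] := Mx _ (nbhsx_ballx x e e0).
by exists y => //; move: xy; rewrite -ball_normE.
Qed.

Lemma inner_closure (M : set H) x y :
  (forall z, M z -> inner x z = 0) -> closure M y -> inner x y = 0.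
Proof.
move=> xM My; apply/eqP; rewrite -normr_le0; apply/ler_addgt0Pl => e e0.
pose c := (`|x| + 1) ^+ 2 *+ 2.
have c0 : 0 < c by rewrite pmulrn_lgt0// exprn_gt0// ltr_wpDl.
have d0 : 0 < e / c by rewrite divr_gt0.
have [z Mz yz] := closure_dist _ _ My _ d0.
(* The bound [inner_le] is not homogeneous; rescaling [y - z] to norm at most 1 bounds its inner
   product with [x] by [c], and the factor [e / c] turns this into [e]. *)
have -> : inner x y = (e / c) *: inner x ((e / c)^-1 *: (y - z)).
  by rewrite innerZr scalerA mulfV ?gt_eqF// scale1r innerBr (xM z)// subr0.
rewrite addr0 normrZ gtr0_norm// -ler_pdivlMl//.
have -> : (e / c)^-1 * e = c by rewrite invf_div divfK ?gt_eqF.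
apply: (le_trans (inner_le _ _)); rewrite lerMn2r/= lerXn2r ?nnegrE ?addr_ge0//.
by rewrite lerD2l normrZ gtr0_norm ?invr_gt0// ler_pdivrMl// mulr1 ltW.
Qed.

Lemma orthocompl_range S : S = adj S ->
  orthocompl (closure (range S)) = [set x | S x = 0].
Proof.
move=> SE; apply/seteqP; split=> x /= Sx.
  apply: inner_inj => z; rewrite inner0r -selfadj_inner//.
  by apply/inner_eq0C/Sx/subset_closure; exists z.
move=> y; apply: inner_closure => _ [z _ <-].
by rewrite -selfadj_inner// Sx inner0l.
Qed.

(** * Norms and kernels for projections and their sums *)

Lemma norm_inner_eq x y : inner x x = inner y y -> `|x| = `|y|.
Proof.
move=> xy; apply/eqP; rewrite -(@eqrXn2 _ 2)//.
by apply/eqP; rewrite !inner_norm xy.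
Qed.

(** The reflection [U = P + P - 1] is self-adjoint with [U * U = 1], so it preserves [inner x x]. *)
Lemma proj_reflection P x : is_projection P -> `|P x + P x - x| = `|x|.
Proof.
move=> [PP PE]; apply: norm_inner_eq.
pose U := P + P - 1.
have UE : U = adj U by rewrite !adjD adjN adj1 -PE.
rewrite -[P x + P x - x]/((P + P : adjop H) x - (1 : adjop H) x) -adjopBE.
rewrite -/U selfadj_inner// -adjopME.
congr (inner x _).
suff -> : U * U = 1 by [].
rewrite /U mulrBl !mulrBr !mulrDl !mulrDr !mul1r !mulr1 -!PP.
by rewrite addrK opprB addrCA subrr addr0.
Qed.

Lemma proj_norm P x : is_projection P -> `|P x| <= `|x|.
Proof.
move=> projP; rewrite -(ler_pMn2r (_ : 0 < 2)%N)// -normrMn mulr2n.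
rewrite -[P x + P x](subrK x) (le_trans (ler_normD _ _))//.
by rewrite proj_reflection// mulr2n.
Qed.

Lemma proj_add_norm P Q x : is_projection P -> is_projection Q ->
  `|(P + Q - 1) x| <= `|x|.
Proof.
move=> projP projQ; rewrite -(ler_pMn2r (_ : 0 < 2)%N)// -normrMn !adjopE.
have -> : (P x + Q x - x) *+ 2 = (P x + P x - x) + (Q x + Q x - x).
  by rewrite mulr2n addrACA [in RHS]addrACA (addrACA (P x)).
by rewrite (le_trans (ler_normD _ _))// !proj_reflection// mulr2n.
Qed.

(* If y = P x = - Q x then y is fixed by P and Q, so
   2<y, y> = <y, P x> - <y, Q x> = <y, x> - <y, x> = 0. *)
Lemma proj_add_ker P Q x : is_projection P -> is_projection Q ->
  (P + Q) x = 0 -> P x = 0 /\ Q x = 0.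
Proof.
move=> [PP PE] [QQ QE]; rewrite adjopE => /eqP; rewrite addr_eq0 => /eqP PQ.
suff Px : P x = 0 by split=> //; apply: oppr_inj; rewrite -PQ Px oppr0.
have Py : P (P x) = P x by rewrite -adjopME -PP.
have Qy : Q (P x) = P x by rewrite PQ raddfN /= -adjopME -QQ.
have yx : inner (P x) (P x) = inner (P x) x by rewrite -selfadj_inner// Py.
have yx' : - inner (P x) (P x) = inner (P x) x.
  rewrite -[in RHS]Qy (selfadj_inner Q)// -innerNr.
  by congr inner; rewrite PQ opprK.
apply: inner_eq0; apply/eqP; move/eqP: yx'; rewrite -yx eq_sym -subr_eq0 opprK.
by rewrite -mulr2n -scaler_nat scaler_eq0 pnatr_eq0.
Qed.

(** * Inverses of self-adjoint operators *)

Lemma adjZ_ge0 e T : 0 <= e -> adj (e *: T) = e *: adj T.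
Proof.
move=> /ger0_real/RRe_real <-; rewrite adjZ; congr (_ *: _).
by apply/eqP; rewrite eq_complex /= oppr0 !eqxx.
Qed.

(** Solving [B x = y] means finding a fixed point of [x] |-> [a^-1 *: (y - W x)], a contraction with
    constant [a^-1]. As [B] is self-adjoint, a choice of preimages is its own adjoint, hence an
    operator [U]; then [U * B = 1] is the adjoint of [B * U = 1]. *)
Lemma contraction_inverse W (a : R[i]) : W = adj W ->
    (forall x, `|W x| <= `|x|) -> 1 < a ->
  exists U, U * (a *: (1 : adjop H) + W) = 1 /\ (a *: (1 : adjop H) + W) * U = 1.
Proof.
move=> WE W1 a1; have a0 : 0 < a by rewrite (lt_trans ltr01).
pose B := a *: (1 : adjop H) + W; rewrite -/B.
have BE : B = adj B by rewrite adjD adjZ_ge0 ?ltW// adj1 -WE.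
have surjB y : exists x, B x = y.
  have [x xE] : exists x, a^-1 *: (y - W x) = x.
    apply: (complex_contraction_fixpoint _ _ _ a^-1).
      by rewrite invr_gt0 a0 invf_lt1.
    move=> u v; rewrite -scalerBr normrZ gtr0_norm ?invr_gt0// ler_wpM2l//.
      by rewrite invr_ge0 ltW.
    by rewrite opprB addrC addrA subrK -raddfB (le_trans (W1 _))// distrC.
  exists x; rewrite !adjopE -[X in a *: X + _]xE scalerA mulfV ?gt_eqF//.
  by rewrite scale1r subrK.
have [f fE] := choice surjB.
have fadj x y : inner (f x) y = inner x (f y).
  by rewrite -{1}(fE y) -selfadj_inner// fE.
pose U := AdjOp fadj.
have BU : B * U = 1 by exact: adjop_ext.
have UE : U = adj U by exact: adjop_ext.
by exists U; split=> //; rewrite BE UE -adjM BU adj1.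
Qed.

Lemma opinv_unique S U : U * S = 1 -> S * U = 1 -> opinv S = U.
Proof.
move=> US SU; have [OS SO] : opinv S * S = 1 /\ S * opinv S = 1.
  by apply: (@xgetPex _ 0 [set V : adjop H | V * S = 1 /\ S * V = 1]); exists U.
by rewrite -[LHS]mulr1 -SU mulrA OS mul1r.
Qed.

(** * Resolvents of a sum of two projections and their limits *)

Section ProjectionSum.
Variables (P Q : adjop H) (projP : is_projection P) (projQ : is_projection Q).

Lemma proj_add_selfadj : P + Q = adj (P + Q).
Proof. by rewrite adjD -projP.2 -projQ.2. Qed.

Section Resolvent.
Variables (e : R[i]) (e0 : 0 < e).
Let T := opinv (P + Q + e *: (1 : adjop H)).

Lemma resolventK :
  T * (P + Q + e *: (1 : adjop H)) = 1 /\ (P + Q + e *: (1 : adjop H)) * T = 1.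
Proof.
pose W := P + Q - 1.
have WE : W = adj W by rewrite adjD adjN adj1 -proj_add_selfadj.
rewrite /T; have -> : P + Q + e *: (1 : adjop H) = (1 + e) *: (1 : adjop H) + W.
  by rewrite scalerDl scale1r [RHS]addrC addrA subrK.
have W1 x : `|W x| <= `|x| by exact: proj_add_norm.
have [U [UB BU]] : exists U, U * ((1 + e) *: (1 : adjop H) + W) = 1 /\
    ((1 + e) *: (1 : adjop H) + W) * U = 1.
  by apply: contraction_inverse; rewrite // ltrDl.
by rewrite (opinv_unique _ _ UB BU).
Qed.

Lemma resolventE x : P (T x) + Q (T x) + e *: T x = x.
Proof. by rewrite -[RHS]adjop1E -resolventK.2. Qed.

Lemma resolvent_selfadj : T = adj T.
Proof.
have [TB BT] := resolventK.
have BE : P + Q + e *: (1 : adjop H) = adj (P + Q + e *: (1 : adjop H)).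
  by rewrite adjD adjZ_ge0 ?ltW// adj1 -proj_add_selfadj.
by apply: opinv_unique; rewrite BE -adjM ?TB ?BT adj1.
Qed.

(** In [(1 + e) *: T x = x - (P + Q - 1) (T x)] the last term has norm at most that of [T x], which
    cancels against the summand 1 of [1 + e]. *)
Lemma resolvent_norm x : `|e *: T x| <= `|x|.
Proof.
have xE : (1 + e) *: T x = x - (P + Q - 1) (T x).
  by rewrite -{2}(resolventE x) !adjopE opprB addrCA [_ + e *: _]addrC addrK
     scalerDl scale1r.
have : (1 + e) * `|T x| <= `|x| + `|T x|.
  rewrite -{1}[1 + e]gtr0_norm ?addr_gt0// -normrZ xE.
  by rewrite (le_trans (ler_normB _ _))// lerD2l proj_add_norm.
by rewrite mulrDl mul1r addrC lerD2r normrZ gtr0_norm.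
Qed.

Lemma resolvent_range x : `|e *: T ((P + Q) x)| <= e * `|x| *+ 2.
Proof.
have -> : T ((P + Q) x) = x - e *: T x.
  have := congr1 (fun S : adjop H => S x) resolventK.1.
  by rewrite !adjopE raddfD /= linearZ /= => /(canRL (addrK _)).
rewrite normrZ gtr0_norm// -mulrnAr ler_pM2l//.
by rewrite (le_trans (ler_normB _ _))// mulr2n lerD2l resolvent_norm.
Qed.

Lemma resolvent_ker x : (P + Q) x = 0 -> e *: T x = x.
Proof.
move=> Sx; have := congr1 (fun S : adjop H => S x) resolventK.1.
by rewrite adjopME adjopDE Sx add0r !adjopE linearZ.
Qed.

End Resolvent.

Local Notation eps n := (n.+1%:R^-1 : R[i]).

Definition resolvent n : adjop H := opinv (P + Q + eps n *: (1 : adjop H)).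

Lemma eps_gt0 n : 0 < eps n. Proof. by rewrite invr_gt0 ltr0n. Qed.

(** A density argument: on the range itself [resolvent_range] gives decay of order [eps n], and the
    uniform bound [resolvent_norm] extends the limit to the closure. *)
Lemma resolvent_cvg_range x :
  closure (range (P + Q)) x -> eps n *: resolvent n x @[n --> \oo] --> (0 : H).
Proof.
move=> Sx; apply/cvgr0Pnorm_lt => d d0.
have d2 : 0 < d / 2 by rewrite divr_gt0.
have [_ [u _ <-] xu] := closure_dist _ _ Sx _ d2.
have c0 : 0 < `|u| *+ 2 + 1 by rewrite ltr_wpDl// mulrn_wge0.
near=> n.
rewrite -(subrK ((P + Q) u) x) [resolvent n _]raddfD scalerDr [ltRHS]splitr.
apply: (le_lt_trans (ler_normD _ _)); rewrite ltrD//.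
  by apply: (le_lt_trans _ xu); exact: resolvent_norm (eps_gt0 n) _.
apply: (le_lt_trans (resolvent_range _ (eps_gt0 n) _)).
apply: (@le_lt_trans _ _ (eps n * (`|u| *+ 2 + 1))).
  by rewrite -mulrnAr ler_wpM2l ?lerDl// ltW ?eps_gt0.
rewrite -ltr_pdivlMr//; near: n.
by apply: near_infty_natSinv_lt_complex; rewrite divr_gt0.
Unshelve. all: by end_near. Qed.

Lemma resolvent_cvg_decomp x y : closure (range (P + Q)) x -> (P + Q) y = 0 ->
  eps n *: resolvent n (x + y) @[n --> \oo] --> y.
Proof.
move=> Sx Sy; rewrite -[y in _ --> y]add0r.
under eq_fun do rewrite [resolvent _ _]raddfD scalerDr.
apply: cvgD; first exact: resolvent_cvg_range.
rewrite (_ : (fun n => _) = cst y); first exact: cvg_cst.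
by apply/funext => n; exact: resolvent_ker (eps_gt0 n) _ Sy.
Qed.

Hypothesis complPQ : orthocomplemented (closure (range (P + Q : adjop H))).

Lemma proj_add_decomp x : exists y z,
  [/\ closure (range (P + Q)) y, (P + Q) z = 0, inner z y = 0 & x = y + z].
Proof.
have [y [z [Sy Oz xE]]] := complPQ x; exists y, z; split=> //; last exact: Oz.
have /seteqP[SN _] := orthocompl_range _ proj_add_selfadj.
exact: (SN z Oz).
Qed.

(** The vectors [eps n *: resolvent n x] tend to the component of [x] in the kernel of [P + Q],
    which [D] kills. The lemma serves [D = P] and [D = Q]. *)
Lemma resolvent_cvg0l D x :
  (forall y, `|D y| <= `|y|) -> (forall y, (P + Q) y = 0 -> D y = 0) ->
  eps n *: D (resolvent n x) @[n --> \oo] --> (0 : H).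
Proof.
move=> D1 DS; have [y [z [Sy Sz _ ->]]] := proj_add_decomp x.
under eq_fun do rewrite -(adjop_scalable D).
rewrite -(DS _ Sz); apply: nonexpansive_cvg => //.
exact: resolvent_cvg_decomp.
Qed.

(** The kernel component [z] of [D x] is zero, because [inner z z = inner z (D x) = inner (D z) x =
    0]; so [D x] lies in the closure of the range. *)
Lemma resolvent_cvg0r D x :
  D = adj D -> (forall y, (P + Q) y = 0 -> D y = 0) ->
  eps n *: resolvent n (D x) @[n --> \oo] --> (0 : H).
Proof.
move=> DE DS; have [y [z [Sy Sz zy DxE]]] := proj_add_decomp (D x).
suff z0 : z = 0 by rewrite DxE z0 addr0; exact: resolvent_cvg_range.
apply: inner_eq0; rewrite -{2}(addKr y z) -DxE addrC innerBr zy subr0.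
by rewrite -selfadj_inner// DS// inner0l.
Qed.

End ProjectionSum.

(** * Strict limits, kernel projections and the resolvent identity for operators *)

Lemma strict_cvgD (u v : nat -> adjop H) S T :
  strict_cvg u S -> strict_cvg v T -> strict_cvg (fun n => u n + v n) (S + T).
Proof.
move=> /strict_cvgP uS /strict_cvgP vT; apply/strict_cvgP => x.
by split; apply: cvgD; [exact: (uS x).1|exact: (vT x).1|exact: (uS x).2|
  exact: (vT x).2].
Qed.

Lemma strict_cvgB (u v : nat -> adjop H) S T :
  strict_cvg u S -> strict_cvg v T -> strict_cvg (fun n => u n - v n) (S - T).
Proof.
move=> /strict_cvgP uS /strict_cvgP vT; apply/strict_cvgP => x.
rewrite adjD adjN !adjopE.
under [X in X @ _ --> _]eq_fun do rewrite !adjopE.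
under [X in _ /\ (X @ _ --> _)]eq_fun do rewrite adjD adjN !adjopE.
by split; apply: cvgB; [exact: (uS x).1|exact: (vT x).1|exact: (uS x).2|
  exact: (vT x).2].
Qed.

Lemma ker_projection S : S = adj S ->
    orthocomplemented (closure (range S)) ->
  exists E, [/\ E = E * E, E = adj E, forall x, S (E x) = 0,
    forall z, S z = 0 -> E z = z & forall x, closure (range S) (x - E x)].
Proof.
move=> SE complS; have SO := orthocompl_range _ SE.
have ker_inner z y : S z = 0 -> closure (range S) y -> inner z y = 0.
  by move=> Sz; have /seteqP[_ KO] := SO; exact: (KO z Sz).
have dec x : exists z, S z = 0 /\ closure (range S) (x - z).
  have [y [z [Sy Oz ->]]] := complS x; exists z; rewrite addrK; split=> //.
  by have /seteqP[OK _] := SO; exact: (OK z Oz).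
have [f fE] := choice dec.
have inner_f z y : S z = 0 -> inner z (f y) = inner z y.
  move=> Sz; apply/eqP; rewrite eq_sym -subr_eq0 -innerBr; apply/eqP.
  by apply: ker_inner => //; exact: (fE y).2.
(* Both sides equal [inner (f x) (f y)], by [inner_f] in either argument. *)
have fadj x y : inner (f x) y = inner x (f y).
  rewrite -(inner_f (f x) y (fE x).1) inner_sym.
  by rewrite (inner_f (f y) x (fE y).1) -inner_sym.
pose E := AdjOp fadj.
have Eker z : S z = 0 -> E z = z.
  by move=> Sz; apply: inner_inj => w; rewrite -fadj inner_sym inner_f// -inner_sym.
exists E; split=> //.
- by apply: adjop_ext => x; rewrite adjopME (Eker (E x))//; exact: (fE x).1.
- exact: adjop_ext.
- by move=> x; exact: (fE x).1.
- by move=> x; exact: (fE x).2.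
Qed.

Local Notation eps n := (n.+1%:R^-1 : R[i]).

Lemma resolventC P Q n : resolvent P Q n = resolvent Q P n.
Proof. by rewrite /resolvent (addrC P). Qed.

Lemma adjopZMl e S T : e *: S * T = e *: (S * T).
Proof. exact: adjop_ext. Qed.

Lemma scale1M e S : e *: (1 : adjop H) * S = e *: S.
Proof. exact: adjop_ext. Qed.

Lemma mulM_scale1 e S : S * (e *: (1 : adjop H)) = e *: S.
Proof. by apply: adjop_ext => x; rewrite !adjopE linearZ. Qed.

Lemma proj_sub_resolventE P Q (projP : is_projection P)
    (projQ : is_projection Q) n x :
  (P - P * resolvent P Q n * P) x =
  2^-1 *: (eps n *: P (resolvent P Q n x) +
           eps n *: P (resolvent (1 - P) (1 - Q) n x)).
Proof.
set T := resolvent P Q n; set T' := resolvent (1 - P) (1 - Q) n.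
have [TK KT] := resolventK _ _ projP projQ _ (eps_gt0 n).
have [T'K KT'] := resolventK _ _ (is_projection_compl _ projP)
  (is_projection_compl _ projQ) _ (eps_gt0 n).
have AE : (P - P * T * P) *+ 2 = eps n *: P * (T + T').
  rewrite -scale1M; apply: projection_resolvent_identity => //.
  - exact: esym projP.1.
  - exact: esym projQ.1.
  - by move=> S; rewrite scale1M mulM_scale1.
  - exact: TK.
  - exact: KT.
  - exact: T'K.
  - exact: KT'.
apply: (@scalerI _ _ (2 : R[i])); rewrite ?pnatr_eq0//.
rewrite scalerA mulfV ?pnatr_eq0// scale1r scaler_nat.
have := congr1 (fun S : adjop H => S x) AE.
by rewrite mulr2n !adjopE raddfD /= scalerDr mulr2n.
Qed.

(** * The three sequences, and convergence versus complementation *)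

Section TwoProjections.
Variables (P Q : adjop H) (projP : is_projection P) (projQ : is_projection Q).
Hypothesis complPQ : orthocomplemented (closure (range (P + Q : adjop H))).

Let P' := 1 - P.
Let Q' := 1 - Q.
Let projP' : is_projection P' := is_projection_compl _ projP.
Let projQ' : is_projection Q' := is_projection_compl _ projQ.
Let T n := resolvent P Q n.
Let T' n := resolvent P' Q' n.
Let An n := P - P * T n * P.
Let Bn n := P * T n * Q.
Let Cn n := Q - Q * T n * Q.
Let N := closure (range (P' + Q')).

Lemma An_Bn n : Bn n = An n - eps n *: (P * T n).
Proof.
have [TK _] := resolventK _ _ projP projQ _ (eps_gt0 n).
(* Expanding the product gives [P * T n * P + P * T n * Q + eps n *: (P * T n) = P]. *)
have : P * (T n * (P + Q + eps n *: (1 : adjop H))) = P by rewrite TK mulr1.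
rewrite mulrA !mulrDr mulM_scale1 => PE.
apply/esym/eqP; rewrite !subr_eq addrC addrA; apply/eqP/esym.
exact: PE.
Qed.

Lemma Cn_Bn n : Cn n = Bn n + eps n *: (T n * Q).
Proof.
have [_ KT] := resolventK _ _ projP projQ _ (eps_gt0 n).
have : (P + Q + eps n *: (1 : adjop H)) * T n * Q = Q by rewrite KT mul1r.
rewrite !mulrDl scale1M adjopZMl => QE.
apply/eqP; rewrite subr_eq addrAC; apply/eqP/esym.
exact: QE.
Qed.

Let adjT n : T n = adj (T n).
Proof. exact: resolvent_selfadj (eps_gt0 n). Qed.

(** The adjoint of [P * T n] is [T n * P], so the two families of seminorms call for
    [resolvent_cvg0l] and [resolvent_cvg0r] respectively. *)
Lemma strict_cvg_resolvent_l : strict_cvg (fun n => eps n *: (P * T n)) 0.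
Proof.
apply/strict_cvgP => x; split.
  apply: (@resolvent_cvg0l _ _ projP projQ complPQ) => y; first exact: proj_norm.
  by move=> /(proj_add_ker _ _ _ projP projQ)[].
under eq_fun do rewrite adjZ_ge0 ?ltW ?eps_gt0// adjM -projP.2 -adjT.
apply: (@resolvent_cvg0r _ _ projP projQ complPQ); first exact: projP.2.
by move=> y /(proj_add_ker _ _ _ projP projQ)[].
Qed.

Lemma strict_cvg_resolvent_r : strict_cvg (fun n => eps n *: (T n * Q)) 0.
Proof.
apply/strict_cvgP => x; split.
  apply: (@resolvent_cvg0r _ _ projP projQ complPQ); first exact: projQ.2.
  by move=> y /(proj_add_ker _ _ _ projP projQ)[].
under eq_fun do rewrite adjZ_ge0 ?ltW ?eps_gt0// adjM -projQ.2 -adjT.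
apply: (@resolvent_cvg0l _ _ projP projQ complPQ) => y; first exact: proj_norm.
by move=> /(proj_add_ker _ _ _ projP projQ)[].
Qed.

Lemma strict_cvg_AB L : strict_cvg An L <-> strict_cvg Bn L.
Proof.
split=> cL.
  have := strict_cvgB _ _ _ _ cL strict_cvg_resolvent_l; rewrite subr0.
  by under eq_fun do rewrite -An_Bn.
have := strict_cvgD _ _ _ _ cL strict_cvg_resolvent_l; rewrite addr0.
by under eq_fun do rewrite An_Bn subrK.
Qed.

Lemma strict_cvg_BC L : strict_cvg Bn L <-> strict_cvg Cn L.
Proof.
split=> cL.
  have := strict_cvgD _ _ _ _ cL strict_cvg_resolvent_r; rewrite addr0.
  by under eq_fun do rewrite -Cn_Bn.
have := strict_cvgB _ _ _ _ cL strict_cvg_resolvent_r; rewrite subr0.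
by under eq_fun do rewrite Cn_Bn addrK.
Qed.

Lemma compl_ker x : (P' + Q') x = 0 <-> P x = x /\ Q x = x.
Proof.
split=> [/(proj_add_ker _ _ _ projP' projQ')[/eqP Px /eqP Qx]|[Px Qx]].
  by move: Px Qx; rewrite !adjopE !subr_eq0 => /eqP <- /eqP <-.
by rewrite !adjopE Px Qx !subrr addr0.
Qed.

Lemma ker_compl : [set x | (P' + Q') x = 0] = range P `&` range Q.
Proof.
apply/seteqP; split=> x.
  by move=> /compl_ker[Px Qx]; split; exists x.
move=> [[y _ yx] [z _ zx]]; apply/compl_ker; split.
  by rewrite -yx -adjopME -projP.1.
by rewrite -zx -adjopME -projQ.1.
Qed.

Lemma strict_cvg_of_compl : orthocomplemented N ->
  exists2 E, is_projection_onto (range P `&` range Q) E &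
             strict_cvg An (2^-1 *: E).
Proof.
move=> /(ker_projection _ (proj_add_selfadj _ _ projP' projQ'))[E].
move=> [EE Eadj Eker kerE NE]; exists E.
  split; first by split.
  rewrite -ker_compl; apply/seteqP; split=> x.
    by move=> [y _ <-]; exact: Eker.
  by move=> /kerE <-; exists x.
have AE x : An n x @[n --> \oo] --> (2^-1 *: E) x.
  under eq_fun do rewrite (proj_sub_resolventE _ _ projP projQ).
  apply: cvgZl_tmp; rewrite -[E x]add0r; apply: cvgD.
    apply: (@resolvent_cvg0l _ _ projP projQ complPQ) => y; first exact: proj_norm.
    by move=> /(proj_add_ker _ _ _ projP projQ)[].
  (* The remaining term [eps n *: P (T' n x)] tends to [P (E x)], which is [E x] because [E x] lies
     in the kernel of [P' + Q']. *)
  have [PE _] := (compl_ker _).1 (Eker x).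
  rewrite -[E x]PE; under eq_fun do rewrite -(adjop_scalable P).
  apply: nonexpansive_cvg; first by move=> y; exact: proj_norm.
  have := resolvent_cvg_decomp _ _ projP' projQ' _ _ (NE x) (Eker x).
  by rewrite subrK.
apply/strict_cvgP => x; split=> //.
rewrite adjZ_ge0 ?invr_ge0// -Eadj.
(* Each [An n] is self-adjoint, so the adjoint seminorms add nothing new. *)
suff -> : (fun n => adj (An n) x) = (fun n => An n x) by [].
apply/funext => n.
by rewrite /An adjD adjN !adjM -projP.2 -adjT mulrA.
Qed.

Lemma compl_of_strict_cvg S :
  strict_cvg An S -> strict_cvg Cn S -> orthocomplemented N.
Proof.
move=> /strict_cvgP AS /strict_cvgP CS x.
(* Used with [D = P], [u = An] and with [D = Q], [u = Cn]: the part containing [T] vanishes in the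
   limit and leaves the part containing [T']. *)
have half (D : adjop H) (u : nat -> H) : (forall y, (P + Q) y = 0 -> D y = 0) ->
    (forall y, `|D y| <= `|y|) ->
    (forall n, u n = 2^-1 *: (eps n *: D (T n x) + eps n *: D (T' n x))) ->
    u n @[n --> \oo] --> S x -> eps n *: D (T' n x) @[n --> \oo] --> 2 *: S x.
  move=> Dker D1 uE uS; rewrite -[_ *: S x]subr0.
  rewrite (_ : (fun n => _) = (fun n => 2 *: u n - eps n *: D (T n x))).
    by apply: cvgB; [exact: cvgZl_tmp|exact: (@resolvent_cvg0l _ _ projP projQ)].
  apply/funext => n; rewrite uE scalerA mulfV ?pnatr_eq0// scale1r.
  by rewrite addrC addKr.
have PS : eps n *: P (T' n x) @[n --> \oo] --> 2 *: S x.
  apply: (half _ (fun n => An n x)); last exact: (AS x).1.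
  - by move=> y /(proj_add_ker _ _ _ projP projQ)[].
  - by move=> y; exact: proj_norm.
  - by move=> n; exact: proj_sub_resolventE.
have QS : eps n *: Q (T' n x) @[n --> \oo] --> 2 *: S x.
  apply: (half _ (fun n => Cn n x)); last exact: (CS x).1.
  - by move=> y /(proj_add_ker _ _ _ projP projQ)[].
  - by move=> y; exact: proj_norm.
  - move=> n; have := proj_sub_resolventE _ _ projQ projP n x.
    by rewrite (resolventC Q) (resolventC (1 - Q)).
pose f n := eps n *: T' n x.
have f1 n : `|f n| <= `|x| by exact: resolvent_norm (eps_gt0 n) _.
have eps_cvg0 (u : nat -> H) : (forall n, `|u n| <= `|x|) ->
    eps n *: u n @[n --> \oo] --> (0 : H).
  move=> ux; apply/cvgr0Pnorm_lt => e e0; near=> n.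
  rewrite normrZ gtr0_norm ?eps_gt0//.
  apply: (@le_lt_trans _ _ (eps n * (`|x| + 1))).
    by rewrite ler_wpM2l ?(ltW (eps_gt0 _))// (le_trans (ux n))// lerDl.
  rewrite -ltr_pdivlMr ?ltr_wpDl//; near: n.
  by apply: near_infty_natSinv_lt_complex; rewrite divr_gt0// ltr_wpDl.
(* This is [(P' + Q' + eps n) (f n) = eps n *: x] solved for [f n]; it expresses [f n] through terms
   whose limits are known. *)
have fE n : f n = 2^-1 *: ((eps n *: P (T' n x) + eps n *: Q (T' n x)) +
    (eps n *: x - eps n *: f n)).
  have xE : eps n *: x - eps n *: f n =
      (f n + f n) - (eps n *: P (T' n x) + eps n *: Q (T' n x)).
    rewrite -{1}(resolventE _ _ projP' projQ' _ (eps_gt0 n) x) !adjopE scalerDr.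
    by rewrite addrK scalerDr !scalerBr addrACA -opprD.
  by rewrite xE addrC subrK scalerDr -scalerDl -div1r -splitr scale1r.
have fS : f n @[n --> \oo] --> 2 *: S x.
  rewrite (_ : 2 *: S x = 2^-1 *: ((2 *: S x + 2 *: S x) + (0 - 0))); last first.
    by rewrite subrr addr0 [RHS]scalerDr -scalerDl -div1r -splitr scale1r.
  under eq_fun do rewrite fE.
  by apply: cvgZl_tmp; apply: cvgD; [exact: cvgD|apply: cvgB; exact: eps_cvg0].
(* [D (f n)] tends both to [2 *: S x] and, by continuity of [D], to [D (2 *: S x)]. *)
have fix_lim D : is_projection D -> eps n *: D (T' n x) @[n --> \oo] --> 2 *: S x ->
    D (2 *: S x) = 2 *: S x.
  move=> projD DS.
  have DfE : (fun n => D (f n)) = (fun n => eps n *: D (T' n x)).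
    by apply/funext => n; exact: adjop_scalable.
  apply: (cvg_unique (@norm_hausdorff _ H) _ DS); rewrite -DfE.
  by apply: nonexpansive_cvg => // y; exact: proj_norm.
(* Since [x - f n = (P' + Q') (T' n x)], the limit [x - 2 *: S x] lies in [N]; the other summand is
   fixed by [P] and [Q], hence orthogonal to [N]. *)
exists (x - 2 *: S x), (2 *: S x); split; last by rewrite subrK.
  apply: (@closed_cvg _ _ \oo eventually_filter (fun n => x - f n) N
    (@closed_closure _ _)).
    apply: nearW => n; apply: subset_closure; exists (T' n x) => //.
    apply: (addIr (f n)); rewrite subrK.
    exact: resolventE _ _ projP' projQ' _ (eps_gt0 n) x.
  by apply: cvgB => //; exact: cvg_cst.
have /seteqP[_] := orthocompl_range _ (proj_add_selfadj _ _ projP' projQ').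
by apply; apply/compl_ker; split; apply: fix_lim.
Unshelve. all: by end_near. Qed.

End TwoProjections.

End HilbertModule.

Theorem theorem2p5 (R : realType) (A : cstarAlgType R) (H : hilbertModType A)
    (P Q : adjop H)
    (projP : is_projection P) (projQ : is_projection Q)
    (complPQ : orthocomplemented (closure (range (P + Q : adjop H)))) :
  (* the n-th terms below are those of index n + 1 >= 1 *)
  let T (n : nat) : adjop H := opinv (P + Q + (n.+1%:R^-1 : R[i]) *: (1 : adjop H)) in
  let An (n : nat) : adjop H := P - P * T n * P in
  let Bn (n : nat) : adjop H := P * T n * Q in
  let Cn (n : nat) : adjop H := Q - Q * T n * Q in
  let M : set H := range P `&` range Q in
  let N : set H := closure (range ((2 : R[i]) *: (1 : adjop H) - P - Q : adjop H)) in
  let cond_i : Prop :=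
    (exists L, strict_cvg An L) \/ (exists L, strict_cvg Bn L) \/
    (exists L, strict_cvg Cn L) in
  let cond_ii : Prop :=
    exists L, [/\ strict_cvg An L, strict_cvg Bn L & strict_cvg Cn L] in
  let cond_iii : Prop := orthocomplemented M /\ orthocompl M = N in
  let cond_iv : Prop := orthocomplemented N in
  [<-> cond_i; cond_ii; cond_iii; cond_iv] /\
  (cond_i \/ cond_ii \/ cond_iii \/ cond_iv ->
    exists PM : adjop H, is_projection_onto M PM /\
      [/\ strict_cvg An ((2^-1 : R[i]) *: PM),
          strict_cvg Bn ((2^-1 : R[i]) *: PM) &
          strict_cvg Cn ((2^-1 : R[i]) *: PM)]).
Proof.
move=> T An Bn Cn M N cond_i cond_ii cond_iii cond_iv.
have NE : N = closure (range ((1 - P) + (1 - Q) : adjop H)).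
  have GE : (2 : R[i]) *: (1 : adjop H) - P - Q = (1 - P) + (1 - Q).
    by rewrite scaler_nat mulr2n [RHS]addrACA addrA.
  by rewrite /N GE.
have AB L : strict_cvg An L <-> strict_cvg Bn L by exact: strict_cvg_AB.
have BC L : strict_cvg Bn L <-> strict_cvg Cn L by exact: strict_cvg_BC.
(* Condition (iv) is the hub: (i) and (iii) each imply it, and it yields (ii), (iii) and the value
   of the limit. *)
have i_iv : cond_i -> cond_iv.
  rewrite /cond_iv NE => iH.
  have [L AL] : exists L, strict_cvg An L.
    case: iH => [//|[[L BL]|[L CL]]]; exists L; first exact/AB.
    exact/AB/BC.
  by apply: (compl_of_strict_cvg _ _ _ _ _ projP projQ complPQ L) => //; exact/BC/AB.
have iv_lim : cond_iv -> exists PM : adjop H, is_projection_onto M PM /\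
      [/\ strict_cvg An ((2^-1 : R[i]) *: PM),
          strict_cvg Bn ((2^-1 : R[i]) *: PM) &
          strict_cvg Cn ((2^-1 : R[i]) *: PM)].
  rewrite /cond_iv NE => /(strict_cvg_of_compl _ _ _ _ _ projP projQ complPQ)[E ME AE].
  by exists E; split=> //; split=> //; [exact/AB|exact/BC/AB].
have iv_ii : cond_iv -> cond_ii.
  by move=> /iv_lim[E [_ EE]]; exists (2^-1 *: E).
have ii_i : cond_ii -> cond_i by move=> [L [AL _ _]]; left; exists L.
have ME : orthocompl N = M.
  rewrite NE orthocompl_range; last
    by apply: proj_add_selfadj; exact: is_projection_compl.
  exact: ker_compl.
have iv_iii : cond_iv -> cond_iii.
  move=> compN.
  have NM x : N x -> orthocompl M x.
    by move=> Nx y; rewrite -ME => Ny; apply: inner_eq0C; exact: Ny.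
  split.
    move=> x; have [y [z [Ny]]] := compN x; rewrite ME => Mz ->.
    by exists z, y; split=> //; [exact: NM|rewrite addrC].
  (* For [x] orthogonal to [M], the component [z] of [x] in [M] is orthogonal to both [x] and [y],
     hence to [z = x - y], so it vanishes. *)
  apply/seteqP; split=> [x Mx|]; last exact: NM.
  have [y [z [Ny Oz xE]]] := compN x; have Mz : M z by rewrite -ME.
  suff z0 : z = 0 by rewrite xE z0 addr0.
  apply: inner_eq0; rewrite -{1}(addKr y z) -xE addrC.
  apply: inner_eq0C.
  by rewrite innerBr (inner_eq0C _ _ _ _ _ (Mx _ Mz)) (Oz _ Ny) subr0.
(* As [orthocompl N = M], the decomposition along [M] and [orthocompl M = N] serves for [N] with its
   summands swapped. *)
have iii_iv : cond_iii -> cond_iv.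
  move=> [compM MN] x; have [y [z [My]]] := compM x; rewrite MN => Nz ->.
  exists z, y; split=> //; last by rewrite addrC.
  by rewrite ME.
split.
  by tfae; [move=> /i_iv/iv_ii|move=> /ii_i/i_iv/iv_iii| |move=> /iv_ii/ii_i].
by case=> [/i_iv|[/ii_i/i_iv|[/iii_iv|]]].
Qed.
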